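(* Let $L_4$ be the $3$-dimensional complex Lie algebra with basis $z_1,z_2,z_3$ and nonzero brackets $[z_3,z_1]=z_2$, $[z_3,z_2]=z_1$. There is a unique subalgebra of $\mathfrak{so}(4,\mathbb{C})$ isomorphic to $L_4$, up to inner automorphism: $$L_4^1=\langle x_1,\ x_2,\ h_1-h_2\rangle.$$
   Context: $\mathfrak{so}(4,\mathbb{C})\cong\mathfrak{sl}(2,\mathbb{C})\oplus\mathfrak{sl}(2,\mathbb{C})$ is realized as the Lie algebra of $4\times4$ complex block diagonal matrices with two traceless $2\times 2$ diagonal blocks. With $E_{ij}$ the $4\times 4$ matrix units, its Chevalley basis is $x_1=E_{12}$, $y_1=E_{21}$, $h_1=E_{11}-E_{22}$, $x_2=E_{34}$, $y_2=E_{43}$, $h_2=E_{33}-E_{44}$. The notation $\langle\cdots\rangle$ denotes complex linear span. The inner automorphisms of $\mathfrak{so}(4,\mathbb{C})$ are the maps $X\mapsto AXA^{-1}$ with $A\in SL(2,\mathbb{C})\times SL(2,\mathbb{C})$ (block diagonal $4\times4$ matrices with both $2\times2$ blocks of determinant $1$). Two subalgebras $S,S'$ are equivalent (up to inner automorphism), written $S\sim S'$, if $\psi(S)=S'$ for some inner automorphism $\psi$ of $\mathfrak{so}(4,\mathbb{C})$. Brackets of basis elements not listed and not determined by antisymmetry are zero. *)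

(* Defs.v *)
From HB Require Import structures.
From mathcomp Require Import all_boot all_order all_algebra.
From mathcomp Require Import ring.
From mathcomp Require Import complex reals.

Set Implicit Arguments.
Unset Strict Implicit.
Unset Printing Implicit Defensive.

Import GRing.Theory.
Local Open Scope ring_scope.

HB.mixin Record isLieAlgebra (K : fieldType) L of Vector K L := {
  lie : L -> L -> L;
  lieDl : forall x y z, lie (x + y) z = lie x z + lie y z;
  lieZl : forall (a : K) x y, lie (a *: x) y = a *: lie x y;
  lieDr : forall x y z, lie x (y + z) = lie x y + lie x z;
  lieZr : forall (a : K) x y, lie x (a *: y) = a *: lie x y;
  liexx : forall x, lie x x = 0;
  lie_jacobi : forall x y z,
    lie x (lie y z) + lie y (lie z x) + lie z (lie x y) = 0
}.

#[short(type="lieAlgType")]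
HB.structure Definition LieAlgebra (K : fieldType) :=
  {L of isLieAlgebra K L & Vector K L}.

Definition lie_isomorphic (K : fieldType) (L L' : lieAlgType K) : Prop :=
  exists2 f : {linear L -> L'},
    bijective f & forall x y, f (lie x y) = lie (f x) (f y).

Definition lie_closed (K : fieldType) (L : lieAlgType K) (U : {vspace L}) :=
  forall x y, x \in U -> y \in U -> lie x y \in U.

Record lieSubalg (K : fieldType) (L : lieAlgType K) := LieSubalg {
  lsval :> {vspace L};
  lsvalP : lie_closed lsval
}.

(* The carrier of a subalgebra S is the type [subvs_of S]. *)
Section SubalgebraLie.
Variables (K : fieldType) (L : lieAlgType K) (S : lieSubalg L).

Definition sub_lie (u v : subvs_of (lsval S)) : subvs_of (lsval S) :=
  Subvs (lsvalP (subvsP u) (subvsP v)).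

Fact sub_lieDl x y z : sub_lie (x + y) z = sub_lie x z + sub_lie y z.
Proof. by apply: val_inj; rewrite /= lieDl. Qed.
Fact sub_lieZl (a : K) x y : sub_lie (a *: x) y = a *: sub_lie x y.
Proof. by apply: val_inj; rewrite /= lieZl. Qed.
Fact sub_lieDr x y z : sub_lie x (y + z) = sub_lie x y + sub_lie x z.
Proof. by apply: val_inj; rewrite /= lieDr. Qed.
Fact sub_lieZr (a : K) x y : sub_lie x (a *: y) = a *: sub_lie x y.
Proof. by apply: val_inj; rewrite /= lieZr. Qed.
Fact sub_liexx x : sub_lie x x = 0.
Proof. by apply: val_inj; rewrite /= liexx. Qed.
Fact sub_lie_jacobi x y z :
  sub_lie x (sub_lie y z) + sub_lie y (sub_lie z x) + sub_lie z (sub_lie x y)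
    = 0.
Proof. by apply: val_inj; rewrite /= lie_jacobi. Qed.

HB.instance Definition _ := isLieAlgebra.Build K (subvs_of (lsval S))
  sub_lieDl sub_lieZl sub_lieDr sub_lieZr sub_liexx sub_lie_jacobi.
End SubalgebraLie.

Section MatrixLie.
Variables (K : fieldType) (n : nat).
Implicit Types A B C : 'M[K]_n.

Definition mx_lie A B := A *m B - B *m A.

Fact mx_lieDl A B C : mx_lie (A + B) C = mx_lie A C + mx_lie B C.
Proof. by rewrite /mx_lie mulmxDl mulmxDr opprD addrACA. Qed.
Fact mx_lieZl (a : K) A B : mx_lie (a *: A) B = a *: mx_lie A B.
Proof. by rewrite /mx_lie -scalemxAl -scalemxAr scalerBr. Qed.
Fact mx_lieDr A B C : mx_lie A (B + C) = mx_lie A B + mx_lie A C.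
Proof. by rewrite /mx_lie mulmxDl mulmxDr opprD addrACA. Qed.
Fact mx_lieZr (a : K) A B : mx_lie A (a *: B) = a *: mx_lie A B.
Proof. by rewrite /mx_lie -scalemxAl -scalemxAr scalerBr. Qed.
Fact mx_liexx A : mx_lie A A = 0.
Proof. exact: subrr. Qed.
Fact mx_lie_jacobi A B C :
  mx_lie A (mx_lie B C) + mx_lie B (mx_lie C A) + mx_lie C (mx_lie A B) = 0.
Proof.
rewrite /mx_lie !(mulmxBl, mulmxBr) !mulmxA.
by apply/matrixP => i j; rewrite !mxE; ring.
Qed.

HB.instance Definition _ := isLieAlgebra.Build K 'M[K]_n
  mx_lieDl mx_lieZl mx_lieDr mx_lieZr mx_liexx mx_lie_jacobi.
End MatrixLie.

(* Coordinates 0, 1, 2 are those along z_1, z_2, z_3; the bracket is the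
   bilinear alternating extension of [z_3, z_1] = z_2, [z_3, z_2] = z_1 and
   [z_1, z_2] = 0 (see L4_lieE). *)
Definition L4 (K : fieldType) : Type := 'rV[K]_3.

Section L4.
Variable K : fieldType.

HB.instance Definition _ := Vector.on (L4 K).

Definition L4_basis (i : 'I_3) : L4 K := delta_mx 0 i.

Definition L4_lie (u v : L4 K) : L4 K :=
  (u 0 2 * v 0 1 - u 0 1 * v 0 2) *: L4_basis 0
  + (u 0 2 * v 0 0 - u 0 0 * v 0 2) *: L4_basis 1.

Fact L4_lieDl x y z : L4_lie (x + y) z = L4_lie x z + L4_lie y z.
Proof. by apply/rowP => i; rewrite !mxE; ring. Qed.
Fact L4_lieZl (a : K) x y : L4_lie (a *: x) y = a *: L4_lie x y.
Proof. by apply/rowP => i; rewrite !mxE; ring. Qed.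
Fact L4_lieDr x y z : L4_lie x (y + z) = L4_lie x y + L4_lie x z.
Proof. by apply/rowP => i; rewrite !mxE; ring. Qed.
Fact L4_lieZr (a : K) x y : L4_lie x (a *: y) = a *: L4_lie x y.
Proof. by apply/rowP => i; rewrite !mxE; ring. Qed.
Fact L4_liexx x : L4_lie x x = 0.
Proof. by apply/rowP => i; rewrite !mxE; ring. Qed.
Fact L4_lie_jacobi x y z :
  L4_lie x (L4_lie y z) + L4_lie y (L4_lie z x) + L4_lie z (L4_lie x y) = 0.
Proof. by apply/rowP => i; rewrite !mxE /=; ring. Qed.

HB.instance Definition _ := isLieAlgebra.Build K (L4 K)
  L4_lieDl L4_lieZl L4_lieDr L4_lieZr L4_liexx L4_lie_jacobi.

Lemma L4_lieE :
  [/\ lie (L4_basis 2) (L4_basis 0) = L4_basis 1,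
      lie (L4_basis 2) (L4_basis 1) = L4_basis 0
    & lie (L4_basis 0) (L4_basis 1) = 0].
Proof. by split; apply/rowP => i; rewrite !mxE /=; ring. Qed.
End L4.

Section SO4.
Variable K : fieldType.

Definition in_so4 (X : 'M[K]_4) : Prop :=
  exists A B : 'M[K]_2,
    [/\ \tr A = 0, \tr B = 0 & X = block_mx A 0 0 B :> 'M_(2 + 2)].

(* Matrix units with indices running from 1 to 4. *)
Definition E (i j : nat) : 'M[K]_4 := delta_mx (inord i.-1) (inord j.-1).

Definition x1 := E 1 2.
Definition y1 := E 2 1.
Definition h1 := E 1 1 - E 2 2.
Definition x2 := E 3 4.
Definition y2 := E 4 3.
Definition h2 := E 3 3 - E 4 4.

(* An inner automorphism of so(4) is given as a map on all 4 x 4 matrices; only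
   its values on so(4) matter below. *)
Definition inner_aut_so4 (psi : 'M[K]_4 -> 'M[K]_4) : Prop :=
  exists A B : 'M[K]_2, \det A = 1 /\ \det B = 1 /\
    let P : 'M[K]_4 := block_mx A 0 0 B : 'M_(2 + 2) in
    forall X, psi X = P *m X *m invmx P.

Definition inner_equiv (S S' : {vspace 'M[K]_4}) : Prop :=
  exists2 psi, inner_aut_so4 psi &
    forall Y, Y \in S' <-> exists2 X, X \in S & Y = psi X.

Definition is_subalg_so4 (S : lieSubalg 'M[K]_4) : Prop :=
  forall X, X \in lsval S -> in_so4 X.
End SO4.

(* Main.v *)
(** In L_4 the vectors u = z_1 + z_2 and v = z_1 - z_2 commute and satisfy
    [z_3, u] = u and [z_3, v] = -v.  Project a copy of this triple in so(4) to
    one sl(2) factor, as (A, B, H): an eigenvector A of ad H for a nonzero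
    eigenvalue is nilpotent, and commuting nilpotent elements of sl(2) are
    proportional, so A and B, lying in different eigenspaces, cannot both be
    nonzero.  As u and v are nonzero, one of them lies in each factor, up to
    the exchange (u, v, z_3) -> (v, u, -z_3).  Conjugating in each SL(2) turns
    u and v into multiples of x_1 and x_2; then z_3 is (h_1 - h_2)/2 modulo
    x_1 and x_2. *)
From HB Require Import structures.
Require Import Defs.
From mathcomp Require Import all_boot all_order all_algebra.
From mathcomp Require Import complex reals.
From mathcomp Require Import ring.
Set Implicit Arguments.
Unset Strict Implicit.
Unset Printing Implicit Defensive.

Import GRing.Theory Num.Theory.
Local Open Scope ring_scope.

(** * Traceless 2 x 2 matrices and eigenvectors of the adjoint action *)

Section Mx2.
Variable K : fieldType.

Definition mx2 (a b c d : K) : 'M[K]_2 :=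
  \matrix_(i, j) if i == 0 then if j == 0 then a else b
                 else if j == 0 then c else d.

Lemma mx2_eta (A : 'M[K]_2) : A = mx2 (A 0 0) (A 0 1) (A 1 0) (A 1 1).
Proof.
apply/matrixP => i j; rewrite mxE.
by case: i j => [[|[|//]] Hi] [[|[|//]] Hj] /=; congr (A _ _); apply: val_inj.
Qed.

Lemma mx2_inj (a b c d a' b' c' d' : K) :
  mx2 a b c d = mx2 a' b' c' d' -> [/\ a = a', b = b', c = c' & d = d'].
Proof.
move=> /matrixP e.
by split; [have:= e 0 0|have:= e 0 1|have:= e 1 0|have:= e 1 1]; rewrite !mxE.
Qed.

Lemma mulmx2 (a b c d a' b' c' d' : K) :
  mx2 a b c d *m mx2 a' b' c' d' =
  mx2 (a * a' + b * c') (a * b' + b * d') (c * a' + d * c') (c * b' + d * d').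
Proof.
apply/matrixP => i j; rewrite !mxE !big_ord_recl big_ord0 !mxE addr0.
by case: i j => [[|[|//]] Hi] [[|[|//]] Hj].
Qed.

Lemma addmx2 (a b c d a' b' c' d' : K) :
  mx2 a b c d + mx2 a' b' c' d' = mx2 (a + a') (b + b') (c + c') (d + d').
Proof.
by apply/matrixP => i j; rewrite !mxE; case: (i == 0); case: (j == 0).
Qed.

Lemma oppmx2 (a b c d : K) : - mx2 a b c d = mx2 (- a) (- b) (- c) (- d).
Proof.
by apply/matrixP => i j; rewrite !mxE; case: (i == 0); case: (j == 0).
Qed.

Lemma scalemx2 (k a b c d : K) :
  k *: mx2 a b c d = mx2 (k * a) (k * b) (k * c) (k * d).
Proof.
by apply/matrixP => i j; rewrite !mxE; case: (i == 0); case: (j == 0).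
Qed.

Lemma mx2_0 : mx2 0 0 0 0 = 0.
Proof.
by apply/matrixP => i j; rewrite !mxE; case: (i == 0); case: (j == 0).
Qed.

Lemma mxtrace2 (a b c d : K) : \tr (mx2 a b c d) = a + d.
Proof. by rewrite /mxtrace !big_ord_recl big_ord0 !mxE addr0. Qed.

Lemma det2 (a b c d : K) : \det (mx2 a b c d) = a * d - b * c.
Proof.
rewrite (expand_det_row _ 0) !big_ord_recl big_ord0 /cofactor !det_mx11 !mxE /=.
by rewrite expr0 expr1; ring.
Qed.

Definition mx2E := (mulmx2, addmx2, oppmx2, scalemx2).

Lemma trace0_mx2 (A : 'M[K]_2) :
  \tr A = 0 -> A = mx2 (A 0 0) (A 0 1) (A 1 0) (- A 0 0).
Proof.
rewrite {1}(mx2_eta A) mxtrace2 => /eqP; rewrite addrC addr_eq0 => /eqP e.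
by rewrite {1}(mx2_eta A) e.
Qed.

Lemma mx_lie_conj n (P A B : 'M[K]_n) : P \in unitmx ->
  mx_lie (P *m A *m invmx P) (P *m B *m invmx P) =
  P *m mx_lie A B *m invmx P.
Proof.
move=> uP; rewrite /mx_lie mulmxBr mulmxBl !mulmxA.
by rewrite !(mulmxKV uP).
Qed.

Lemma conjmx_eq0 n (P A : 'M[K]_n) : P \in unitmx ->
  P *m A *m invmx P = 0 -> A = 0.
Proof.
move=> uP /(congr1 (fun X => invmx P *m X *m P)).
by rewrite mulmx0 mul0mx -!mulmxA mulVmx // mulmx1 mulKmx.
Qed.

Hypothesis two0 : (2 : K) != 0.

(** The trace of A [H, A] vanishes identically, while [H, A] = A turns it into tr(A^2), which is -2
    det A for a traceless A. *)
Lemma sl2_eigen_det (H A : 'M[K]_2) :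
  \tr H = 0 -> \tr A = 0 -> mx_lie H A = A -> \det A = 0.
Proof.
move=> /trace0_mx2 -> /trace0_mx2 ->.
move: (H 0 0) (H 0 1) (H 1 0) (A 0 0) (A 0 1) (A 1 0) => a b c p q r.
rewrite /mx_lie !mx2E det2 => /mx2_inj[e1 e2 e3 _].
apply: (mulfI two0); rewrite mulr0.
(* The middle term is - tr(A [H, A]) written out in entries. *)
transitivity (- (2 * p * (a * p + b * r - (p * a + q * c))
  + (a * q + b * - p - (p * b + q * - a)) * r
  + q * (c * p + - a * r - (r * a + - p * c)))); last by ring.
by rewrite e1 e2 e3; ring.
Qed.

Lemma sl2_nilpotent_conj (A : 'M[K]_2) :
  \tr A = 0 -> \det A = 0 -> A != 0 ->
  exists P k, [/\ \det P = 1, k != 0 & P *m A *m invmx P = mx2 0 k 0 0].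
Proof.
move=> /trace0_mx2 ->; move: (A 0 0) (A 0 1) (A 1 0) => p q r.
rewrite det2 => e nz; have [r0|r0] := eqVneq r 0.
  move: e nz; rewrite r0 mulr0 subr0 mulrN => /eqP.
  rewrite oppr_eq0 mulf_eq0 orbb => /eqP -> nz.
  exists 1%:M, q; split; first exact: det1.
    by apply: contraNneq nz => ->; rewrite oppr0 mx2_0.
  by rewrite invmx1 mul1mx mulmx1 oppr0.
(* The kernel of A is spanned by its first column (p, r), which P sends to (1, 0). Since P sends (1,
   0) to (0, -r), the conjugate of A sends (0, -r) to (1, 0), whence k = -1/r. *)
exists (mx2 0 r^-1 (- r) p), (- r^-1).
have dP : \det (mx2 0 r^-1 (- r) p) = 1 by rewrite det2; field.
split=> //; first by rewrite oppr_eq0 invr_eq0.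
have uP : mx2 0 r^-1 (- r) p \in unitmx by rewrite unitmxE dP unitr1.
apply: (canLR (mulmxK uP)); rewrite !mx2E; congr mx2.
- by field.
- by field.
- by ring.
- by transitivity (p * - p - q * r); [ring | rewrite e; ring].
Qed.

(** The bracket detects only the diagonal and the lower left entry of H; the upper right part of H
    commutes with [mx2 0 k 0 0], so [H 0 1] stays free. *)
Lemma sl2_eigen_std (H : 'M[K]_2) k : k != 0 -> \tr H = 0 ->
  mx_lie H (mx2 0 k 0 0) = mx2 0 k 0 0 -> H = mx2 2^-1 (H 0 1) 0 (- 2^-1).
Proof.
move=> k0 /trace0_mx2 eH; rewrite {1}eH /mx_lie !mx2E => /mx2_inj[e1 e2 _ _].
have c0 : H 1 0 = 0.
  by apply: (mulfI k0); rewrite mulr0 -[RHS]oppr0 -[in RHS]e1; ring.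
have a2 : H 0 0 = 2^-1.
  apply: (mulfI (mulf_neq0 two0 k0)); transitivity k; last by field.
  by rewrite -[RHS]e2; ring.
by rewrite eH a2 c0 !mxE.
Qed.

(** P is chosen for the nilpotent A alone; the bracket relation, carried along by conjugation, then
    determines H up to the entry t. *)
Lemma sl2_eigen_conj (H A : 'M[K]_2) :
  \tr H = 0 -> \tr A = 0 -> mx_lie H A = A -> A != 0 ->
  exists P k t, [/\ \det P = 1, k != 0, P *m A *m invmx P = mx2 0 k 0 0
    & P *m H *m invmx P = mx2 2^-1 t 0 (- 2^-1)].
Proof.
move=> tH tA hA nz.
have [P [k [dP k0 eA]]] :=
  sl2_nilpotent_conj tA (sl2_eigen_det tH tA hA) nz.
have uP : P \in unitmx by rewrite unitmxE dP unitr1.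
exists P, k, ((P *m H *m invmx P) 0 1); split=> //.
apply: sl2_eigen_std k0 _ _; first by rewrite mxtrace_mulC mulKmx.
by rewrite -eA mx_lie_conj // hA.
Qed.

Lemma sl2_eigen_commute (H A B : 'M[K]_2) :
  \tr H = 0 -> \tr A = 0 -> \tr B = 0 ->
  mx_lie H A = A -> mx_lie H B = - B -> mx_lie A B = 0 -> A = 0 \/ B = 0.
Proof.
move=> tH tA tB hA hB hAB; have [->|nz] := eqVneq A 0; [by left | right].
have [P [k [t [dP k0 eA eH]]]] := sl2_eigen_conj tH tA hA nz.
have uP : P \in unitmx by rewrite unitmxE dP unitr1.
apply: (conjmx_eq0 uP).
have := mx_lie_conj H B uP; rewrite hB eH mulmxN mulNmx.
have := mx_lie_conj A B uP; rewrite hAB eA mulmx0 mul0mx.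
have : \tr (P *m B *m invmx P) = 0 by rewrite mxtrace_mulC mulKmx.
move: (P *m B *m invmx P) => B' /trace0_mx2 ->.
move: (B' 0 0) (B' 0 1) (B' 1 0) => a b c.
rewrite -mx2_0 /mx_lie !mx2E => /mx2_inj[e1 e2 _ _] /mx2_inj[_ e3 _ _].
(* Commuting with [mx2 0 k 0 0] forces c = a = 0, which makes B' strictly upper triangular. *)
have c0 : c = 0 by apply: (mulfI k0); rewrite mulr0 -[RHS]e1; ring.
have a0 : a = 0.
  apply: (mulfI (mulf_neq0 two0 k0)); rewrite mulr0 -[RHS]oppr0 -[in RHS]e2.
  by ring.
(* The conjugated H now acts on B' with eigenvalue 1, yet the hypothesis gives -1; hence 2 b = 0. *)
have b0 : b = 0.
  apply: (mulfI two0); rewrite mulr0 -(subrr (- b)) -{1}e3 a0.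
  by field.
by rewrite a0 b0 c0 oppr0.
Qed.
End Mx2.

(** * Block diagonal 4 x 4 matrices *)

Section So4.
Variable K : fieldType.

(** Typed in size 4, which is only convertible to 2 + 2; this is why the block lemmas below are
    applied with explicit sizes. *)
Definition bdiag (A B : 'M[K]_2) : 'M[K]_4 := block_mx A 0 0 B : 'M_(2 + 2).

Lemma mul_bdiag A B C D : bdiag A B *m bdiag C D = bdiag (A *m C) (B *m D).
Proof.
by rewrite /bdiag (@mulmx_block _ 2 2 2 2 2 2) !(mulmx0, mul0mx, addr0, add0r).
Qed.

Lemma add_bdiag A B C D : bdiag A B + bdiag C D = bdiag (A + C) (B + D).
Proof. by rewrite /bdiag (@add_block_mx _ 2 2 2 2) !addr0. Qed.

Lemma opp_bdiag A B : - bdiag A B = bdiag (- A) (- B).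
Proof. by rewrite /bdiag (@opp_block_mx _ 2 2 2 2) !oppr0. Qed.

Lemma scale_bdiag k A B : k *: bdiag A B = bdiag (k *: A) (k *: B).
Proof. by rewrite /bdiag (@scale_block_mx _ 2 2 2 2) !scaler0. Qed.

Lemma bdiag_inj A B C D : bdiag A B = bdiag C D -> A = C /\ B = D.
Proof. by case/(@eq_block_mx _ 2 2 2 2). Qed.

Lemma bdiag0 : bdiag 0 0 = 0.
Proof. exact: (@block_mx0 _ 2 2 2 2). Qed.

Lemma lie_bdiag A B C D :
  lie (bdiag A B) (bdiag C D) = bdiag (mx_lie A C) (mx_lie B D).
Proof. by rewrite /lie /= /mx_lie !mul_bdiag opp_bdiag add_bdiag. Qed.

Lemma invmx_bdiag A B : A \in unitmx -> B \in unitmx ->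
  invmx (bdiag A B) = bdiag (invmx A) (invmx B).
Proof.
move=> uA uB; apply: (@invmx_block_diag _ 2 2).
by rewrite unitmxE (@det_ublock _ 2 2) unitrM -!unitmxE uA.
Qed.

(** Tests on natural numbers and [inord] indices match the form of the matrix units [E], so that on
    concrete indices both sides reduce to numerals. *)
Lemma bdiagE A B i j : bdiag A B i j =
  if (i < 2)%N then if (j < 2)%N then A (inord i) (inord j) else 0
  else if (j < 2)%N then 0 else B (inord (i - 2)) (inord (j - 2)).
Proof.
rewrite /bdiag /block_mx mxE.
have [k ek|k ek] := @splitP 2 2 i; rewrite mxE ek ?ltn_ord ?addKn ?inord_val /=.
  by have [l el|l el] := @splitP 2 2 j; rewrite ?mxE ?el ?ltn_ord ?inord_val.
by have [l el|l el] := @splitP 2 2 j;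
  rewrite ?mxE ?el ?ltn_ord ?addKn ?inord_val.
Qed.

Lemma x1E : x1 K = bdiag (mx2 0 1 0 0) 0.
Proof.
apply/matrixP; case=> [[|[|[|[|//]]]] Hi] [[|[|[|[|//]]]] Hj];
by rewrite bdiagE !mxE -!val_eqE /= !inordK.
Qed.

Lemma x2E : x2 K = bdiag 0 (mx2 0 1 0 0).
Proof.
apply/matrixP; case=> [[|[|[|[|//]]]] Hi] [[|[|[|[|//]]]] Hj];
by rewrite bdiagE !mxE -!val_eqE /= !inordK.
Qed.

Lemma h12E : h1 K - h2 K = bdiag (mx2 1 0 0 (- 1)) (mx2 (- 1) 0 0 1).
Proof.
apply/matrixP; case=> [[|[|[|[|//]]]] Hi] [[|[|[|[|//]]]] Hj];
by rewrite bdiagE !mxE -!val_eqE /= !inordK //=; ring.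
Qed.

(** * The subalgebra spanned by x_1, x_2, h_1 - h_2 and its isomorphism with L_4 *)

Definition L41mx a b c := bdiag (mx2 c a 0 (- c)) (mx2 (- c) b 0 c).

Lemma L41mxE a b c :
  a *: x1 K + b *: x2 K + c *: (h1 K - h2 K) = L41mx a b c.
Proof.
rewrite x1E x2E h12E -!mx2_0 !(scale_bdiag, add_bdiag) !mx2E.
by congr bdiag; congr mx2; ring.
Qed.

Lemma memv_span3 (V : vectType K) (u v w x : V) :
  x \in <<[:: u; v; w]>>%VS <->
  exists a b c, x = a *: u + b *: v + c *: w.
Proof.
rewrite !span_cons span_nil addv0; split.
  case/memv_addP => _ /vlineP[a ->] [_ /memv_addP[_ /vlineP[b ->]
    [_ /vlineP[c ->] ->] ->]].
  by exists a, b, c; rewrite addrA.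
move=> [a [b [c ->]]]; rewrite -addrA.
by rewrite !memv_add ?memvZ ?memv_line.
Qed.

Definition L41_vs := <<[:: x1 K; x2 K; h1 K - h2 K]>>%VS.

Lemma memL41 X : X \in L41_vs <-> exists a b c, X = L41mx a b c.
Proof.
rewrite memv_span3.
by split=> -[a [b [c ->]]]; exists a, b, c; rewrite L41mxE.
Qed.

Lemma lie_L41mx a b c a' b' c' : lie (L41mx a b c) (L41mx a' b' c') =
  L41mx (2 * (c * a' - a * c')) (- 2 * (c * b' - b * c')) 0.
Proof.
by rewrite lie_bdiag /mx_lie !mx2E; congr bdiag; congr mx2; ring.
Qed.

Lemma L41_closed : lie_closed L41_vs.
Proof.
move=> _ _ /memL41[a [b [c ->]]] /memL41[a' [b' [c' ->]]].
by apply/memL41; rewrite lie_L41mx; do 3!eexists.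
Qed.

Definition L41_alg : lieSubalg 'M[K]_4 := LieSubalg L41_closed.

Lemma L41_so4 : is_subalg_so4 L41_alg.
Proof.
move=> _ /memL41[a [b [c ->]]]; do 2!eexists; split; last reflexivity.
  by rewrite mxtrace2 subrr.
by rewrite mxtrace2 addNr.
Qed.

(* The isomorphism to L_4 sends x_1 to z_1 + z_2, x_2 to z_1 - z_2 and
   h_1 - h_2 to 2 z_3. *)
Definition L41_coord (X : 'M[K]_4) : L4 K :=
  let a := X 0 1 in let b := X 2 3 in let c := X 0 0 in
  (a + b) *: L4_basis K 0 + (a - b) *: L4_basis K 1 + (2 * c) *: L4_basis K 2.

Arguments L41_coord : simpl never.

Lemma L41_coord_linear : linear L41_coord.
Proof. by move=> k X Y; apply/rowP => i; rewrite !mxE; ring. Qed.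

Lemma L41_coordE a b c : L41_coord (L41mx a b c) =
  (a + b) *: L4_basis K 0 + (a - b) *: L4_basis K 1 + (2 * c) *: L4_basis K 2.
Proof. by rewrite /L41_coord /L41mx !bdiagE /= !mxE -!val_eqE /= !inordK. Qed.

Hypothesis two0 : (2 : K) != 0.

Lemma L41_iso : lie_isomorphic (subvs_of (lsval L41_alg)) (L4 K).
Proof.
pose f (x : subvs_of (lsval L41_alg)) : L4 K := L41_coord (vsval x).
have f_lin : linear f by move=> k x y; rewrite /f linearP L41_coord_linear.
pose F := GRing.isLinear.Build K _ _ _ f f_lin.
pose fL : {linear _ -> _} := HB.pack f F.
exists fL.
  (* The inverse solves a + b = w_1, a - b = w_2, 2 c = w_3 for the coordinates w_i of w along
     z_i. *)
  exists (fun w : L4 K => vsproj (lsval L41_alg)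
    (L41mx ((w 0 0 + w 0 1) / 2) ((w 0 0 - w 0 1) / 2) (w 0 2 / 2))).
    move=> x; apply: val_inj; rewrite /= /f.
    have /memL41[a [b [c ->]]] := subvsP x.
    rewrite vsprojK; last by apply/memL41; do 3!eexists.
    by rewrite L41_coordE !mxE /=; congr L41mx; field.
  move=> w; rewrite /= /f vsprojK; last by apply/memL41; do 3!eexists.
  rewrite L41_coordE; apply/rowP => -[[|[|[|//]]] Hi]; rewrite !mxE /=.
  - have -> : Ordinal Hi = 0 by apply: val_inj.
    by field.
  - have -> : Ordinal Hi = 1 by apply: val_inj.
    by field.
  - have -> : Ordinal Hi = 2 by apply: val_inj.
    by field.
move=> x y; rewrite /= /f /=.
have /memL41[a [b [c ->]]] := subvsP x.
have /memL41[a' [b' [c' ->]]] := subvsP y.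
rewrite lie_L41mx !L41_coordE /lie /=; apply/rowP => i.
by rewrite !mxE /=; ring.
Qed.

(** * Uniqueness up to inner automorphism *)

(** Pulls z_1 + z_2, z_1 - z_2 and z_3 back along the isomorphism. The uniqueness proof works with
    this eigenbasis of ad z_3 alone. *)
Lemma L4_iso_triple (L : lieAlgType K) : lie_isomorphic L (L4 K) ->
  exists u v z : L, [/\ u != 0, v != 0,
    [/\ lie z u = u, lie z v = - v & lie u v = 0]
    & forall x, exists a b c, x = a *: u + b *: v + c *: z].
Proof.
case=> f [g fK gK] f_lie; have f_inj := can_inj fK.
have g0 w : w != 0 -> g w != 0.
  by apply: contraNneq => e; rewrite -(gK w) e linear0.
pose u := L4_basis K 0 + L4_basis K 1; pose v := L4_basis K 0 - L4_basis K 1.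
exists (g u), (g v), (g (L4_basis K 2)); split; first 1 last.
- apply: g0; apply/eqP => /rowP/(_ 0)/eqP.
  by rewrite !mxE /= subr0 oner_eq0.
- split; apply: f_inj; rewrite ?f_lie ?linearN ?linear0 !gK;
  by apply/rowP => i; rewrite !mxE /=; ring.
- move=> x; pose w := f x.
  exists ((w 0 0 + w 0 1) / 2), ((w 0 0 - w 0 1) / 2), (w 0 2).
  apply: f_inj; rewrite !(linearD, linearZ) /= !gK.
  apply/rowP => -[[|[|[|//]]] Hi]; rewrite !mxE /= -/w.
  + have -> : Ordinal Hi = 0 by apply: val_inj.
    by field.
  + have -> : Ordinal Hi = 1 by apply: val_inj.
    by field.
  + have -> : Ordinal Hi = 2 by apply: val_inj.
    by field.
- apply: g0; apply/eqP => /rowP/(_ 0)/eqP.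
  by rewrite !mxE /= addr0 oner_eq0.
Qed.

(** The two blocks are normalized by independent conjugations P and Q. The leftover upper right
    entries of H and G are absorbed by x_1 and x_2. *)
Lemma inner_equiv_L41 (S : {vspace 'M[K]_4}) (N M H G : 'M[K]_2) :
  (forall X, X \in S <-> exists a b c,
     X = a *: bdiag N 0 + b *: bdiag 0 M + c *: bdiag H G) ->
  \tr N = 0 -> \tr M = 0 -> \tr H = 0 -> \tr G = 0 ->
  mx_lie H N = N -> mx_lie G M = - M -> N != 0 -> M != 0 ->
  inner_equiv S L41_vs.
Proof.
move=> memS tN tM tH tG hN gM nN nM.
have [P [k [t [dP k0 eN eH]]]] := sl2_eigen_conj two0 tH tN hN nN.
(* [sl2_eigen_conj] treats the eigenvalue 1, so in the second block it is applied to - G. *)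
have tG' : \tr (- G) = 0 by rewrite linearN /= tG oppr0.
have gM' : mx_lie (- G) M = M.
  by rewrite /mx_lie mulNmx mulmxN opprK addrC -opprB -/(mx_lie G M) gM opprK.
have [Q [l [s [dQ l0 eM eG]]]] := sl2_eigen_conj two0 tG' tM gM' nM.
have uP : P \in unitmx by rewrite unitmxE dP unitr1.
have uQ : Q \in unitmx by rewrite unitmxE dQ unitr1.
have {}eG : Q *m G *m invmx Q = mx2 (- 2^-1) (- s) 0 2^-1.
  by rewrite -[G]opprK mulmxN mulNmx eG oppmx2 oppr0 opprK.
pose R := bdiag P Q; pose psi X := R *m X *m invmx R.
have psiE a b c : psi (a *: bdiag N 0 + b *: bdiag 0 M + c *: bdiag H G) =
    L41mx (a * k + c * t) (b * l - c * s) (c / 2).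
  rewrite /psi !(mulmxDr, mulmxDl) -!(scalemxAr, scalemxAl) /R invmx_bdiag //.
  rewrite !mul_bdiag !(mulmx0, mul0mx) eN eM eH eG -mx2_0.
  rewrite !(scale_bdiag, add_bdiag) !mx2E.
  by congr bdiag; congr mx2; field.
exists psi; first by exists P, Q.
move=> Y; rewrite memL41; split.
  move=> [a [b [c ->]]].
  (* These coefficients invert the triangular system of [psiE]: first c, then a and b. *)
  exists (((a - 2 * c * t) / k) *: bdiag N 0
    + ((b + 2 * c * s) / l) *: bdiag 0 M + (2 * c) *: bdiag H G).
    by apply/memS; do 3!eexists.
  by rewrite psiE; congr L41mx; field; rewrite ?k0 ?l0 ?two0.
move=> [X /memS[a [b [c ->]]] ->]; rewrite psiE.
by do 3!eexists.
Qed.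

Lemma L41_unique (S : lieSubalg 'M[K]_4) : is_subalg_so4 S ->
  lie_isomorphic (subvs_of (lsval S)) (L4 K) ->
  inner_equiv (lsval S) L41_vs.
Proof.
move=> S_so4 /L4_iso_triple[u [v [z [u0 v0 [zu zv uv] sp]]]].
have memS X : X \in lsval S <-> exists a b c,
    X = a *: vsval u + b *: vsval v + c *: vsval z.
  split=> [XS|[a [b [c ->]]]]; last by rewrite !memvD ?memvZ ?subvsP.
  have [a [b [c e]]] := sp (Subvs XS); exists a, b, c.
  by move/(congr1 val): e => /=.
have {u0} u0 : vsval u != 0 by apply: contraNneq u0 => e; apply/eqP/val_inj.
have {v0} v0 : vsval v != 0 by apply: contraNneq v0 => e; apply/eqP/val_inj.
move/(congr1 val): zu; move/(congr1 val): zv; move/(congr1 val): uv => /=.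
have [A [A' [tA tA' eu]]] := S_so4 _ (subvsP u).
have [B [B' [tB tB' ev]]] := S_so4 _ (subvsP v).
have [H [H' [tH tH' ez]]] := S_so4 _ (subvsP z).
move: eu ev ez memS u0 v0; rewrite -/(bdiag A A') -/(bdiag B B') -/(bdiag H H').
move=> -> -> -> memS u0 v0; rewrite !lie_bdiag opp_bdiag -bdiag0.
move=> /bdiag_inj[cAB cAB'] /bdiag_inj[zB zB'] /bdiag_inj[zA zA'].
(* In each block u or v has zero component. If the same vector vanishes in both blocks, it is zero,
   a contradiction; otherwise u and v lie in different factors. *)
have [A0|B0] := sl2_eigen_commute two0 tH tA tB zA zB cAB;
have [A0'|B0'] := sl2_eigen_commute two0 tH' tA' tB' zA' zB' cAB'; subst.
- by rewrite bdiag0 eqxx in u0.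
- have nA' : A' != 0 by apply: contraNneq u0 => ->; rewrite bdiag0.
  have nB : B != 0 by apply: contraNneq v0 => ->; rewrite bdiag0.
  (* Here v lies in the first factor and u in the second; replacing z by - z exchanges their
     eigenvalues. *)
  apply: (@inner_equiv_L41 _ B A' (- H) (- H')) => //.
  + move=> X; rewrite memS; split=> -[a [b [c ->]]]; exists b, a, (- c);
    by rewrite -opp_bdiag scalerN scaleNr ?opprK (addrC (_ *: _)).
  + by rewrite linearN /= tH oppr0.
  + by rewrite linearN /= tH' oppr0.
  + by rewrite /mx_lie mulNmx mulmxN -opprD -/(mx_lie H B) zB opprK.
  + by rewrite /mx_lie mulNmx mulmxN -opprD -/(mx_lie H' A') zA'.
- apply: (@inner_equiv_L41 _ A B' H H') => //.
  + by apply: contraNneq u0 => ->; rewrite bdiag0.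
  + by apply: contraNneq v0 => ->; rewrite bdiag0.
- by rewrite bdiag0 eqxx in v0.
Qed.
End So4.

Theorem theorem5p7 (R : realType) :
  exists L41 : lieSubalg 'M[R[i]]_4,
    [/\ lsval L41 = <<[:: x1 R[i]; x2 R[i]; h1 R[i] - h2 R[i]]>>%VS,
        is_subalg_so4 L41,
        lie_isomorphic (subvs_of (lsval L41)) (L4 R[i])
      & forall S : lieSubalg 'M[R[i]]_4,
          is_subalg_so4 S ->
          lie_isomorphic (subvs_of (lsval S)) (L4 R[i]) ->
          inner_equiv (lsval S) (lsval L41)].
Proof.
have two0 : (2 : R[i]) != 0 by rewrite pnatr_eq0.
exists (L41_alg R[i]); split=> //.
- exact: L41_so4.
- exact: L41_iso.
- exact: L41_unique.
Qed.
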